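(* Let $0\le k\le T$ be such that $I_t=0$ for all $t>k$ (equivalently, such that there exists a measurable function $g:\mathcal V^k\to[0,1]$ with $\mathrm{Harm}(y)=g(y_{\le k})$ almost surely under $P_\theta$). Then for all $t$ with $k<t\le T$, $$\mathbb{E}_{y_{<t}}\Big[\mathrm{Cov}_{y_t\mid y_{<t}}\big(h_t(y_{\le t}),\ \nabla_\theta\log P_\theta(y_t\mid y_{<t})\big)\Big]=0,$$ and hence position $t$ contributes nothing to $\nabla_\theta\mathbb{E}[\mathrm{Harm}(y)]$, i.e. the $t$-th summand in the identity $\nabla_\theta\mathbb{E}[\mathrm{Harm}(y)]=\sum_{s=1}^T\mathbb{E}_{y_{<s}}\big[\mathrm{Cov}_{y_s\mid y_{<s}}(h_s(y_{\le s}),\nabla_\theta\log P_\theta(y_s\mid y_{<s}))\big]$ vanishes.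
   Context: Let $\mathcal V$ be a finite vocabulary and $T\ge 1$ a fixed sequence length. For each $\theta\in\mathbb{R}^d$, $P_\theta$ is a probability distribution on $y=(y_1,\dots,y_T)\in\mathcal V^T$ with autoregressive factorization $P_\theta(y)=\prod_{t=1}^T P_\theta(y_t\mid y_{<t})$, where $y_{<t}=(y_1,\dots,y_{t-1})$ and $y_{\le t}=(y_1,\dots,y_t)$. The conditionals are positive and differentiable in $\theta$. $\mathrm{Harm}:\mathcal V^T\to[0,1]$ is a fixed function. All expectations, variances and covariances are under $y\sim P_\theta$; $\mathrm{Cov}_{y_t\mid y_{<t}}$ is the covariance for $y_t\sim P_\theta(\cdot\mid y_{<t})$ with $y_{<t}$ fixed. Conditional expected harm: $h_t(y_{\le t}):=\mathbb{E}[\mathrm{Harm}(y)\mid y_{\le t}]$, with $h_0=\mathbb{E}[\mathrm{Harm}]$. Harm innovation: $\Delta_t:=h_t(y_{\le t})-h_{t-1}(y_{<t})$. Harm information: $I_t:=\mathbb{E}[\Delta_t^2]=\mathbb{E}[\mathrm{Var}(h_t\mid y_{<t})]$. *)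

(* Defs.v *)
From HB Require Import structures.
From mathcomp Require Import all_boot all_order all_algebra.
From mathcomp Require Import all_classical all_reals all_analysis.

Set Implicit Arguments.
Unset Strict Implicit.
Unset Printing Implicit Defensive.

Import Order.TTheory GRing.Theory Num.Theory.
Import numFieldNormedType.Exports.

Local Open Scope ring_scope.

(* Expectations and covariance for a weight function w on a finite type,
   for scalar and for R^d-valued random variables. *)

Definition mean (R : realType) (X : finType) (w : X -> R) (f : X -> R) : R :=
  \sum_x w x * f x.

Definition vmean (R : realType) (d : nat) (X : finType) (w : X -> R)
    (g : X -> 'rV[R]_d) : 'rV[R]_d :=
  \sum_x w x *: g x.

Definition vcov (R : realType) (d : nat) (X : finType) (w : X -> R)
    (f : X -> R) (g : X -> 'rV[R]_d) : 'rV[R]_d :=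
  vmean w (fun x => (f x - mean w f) *: (g x - vmean w g)).

Definition grad (R : realType) (d : nat) (f : 'rV[R]_d -> R) (theta : 'rV[R]_d)
    : 'rV[R]_d :=
  \row_i 'D_(delta_mx 0 i) f theta.

(* [cond M theta s v] is P_theta(y_t = v | y_{<t} = s) with t = size s + 1, so
   only prefixes s of size < T are meaningful and constrained. *)
Record ar_model (R : realType) (d : nat) (V : finType) (T : nat) := ArModel {
  cond : 'rV[R]_d -> seq V -> V -> R ;
  cond_gt0 : forall theta s v, (size s < T)%N -> 0 < cond theta s v ;
  cond_sum1 : forall theta s, (size s < T)%N -> \sum_v cond theta s v = 1 ;
  cond_diff : forall theta s v, (size s < T)%N ->
    differentiable (fun theta' => cond theta' s v) theta }.

Section Autoregressive.
Context (R : realType) (d : nat) (V : finType) (T : nat).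
Variables (M : ar_model R d V T) (Harm : T.-tuple V -> R).
Implicit Types (theta : 'rV[R]_d) (y : T.-tuple V) (s : seq V) (t : nat).

(* The index t : 'I_T is 0-based: take t y is the prefix preceding tnth y t. *)
Definition joint theta y : R :=
  \prod_(t < T) cond M theta (take t y) (tnth y t).

Definition Pr theta (A : pred (T.-tuple V)) : R :=
  \sum_(y | A y) joint theta y.

Definition has_prefix s : pred (T.-tuple V) := fun y => take (size s) y == s.

(* h_t(s) = E[Harm(y) | y_{<=t} = s], where t = size s. *)
Definition h theta s : R :=
  (\sum_(y | has_prefix s y) joint theta y * Harm y) / Pr theta (has_prefix s).

(* From here on positions are 1-based, 1 <= t <= T:
   y_{<=t} = take t y and y_{<t} = take t.-1 y. *)

Definition innovation theta t y : R :=
  h theta (take t y) - h theta (take t.-1 y).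

Definition harm_info theta t : R :=
  mean (joint theta) (fun y => innovation theta t y ^+ 2).

Definition score theta s (v : V) : 'rV[R]_d :=
  grad (fun theta' => ln (cond M theta' s v)) theta.

(* Cov(h_t(y_{<=t}), grad_theta log P_theta(y_t | y_{<t})) for
   y_t ~ P_theta(. | y_{<t} = s), where t = size s + 1. *)
Definition cond_cov theta s : 'rV[R]_d :=
  vcov (cond M theta s) (fun v => h theta (rcons s v)) (score theta s).

(* The t-th summand of the gradient identity: E_{y_{<t}}[cond_cov y_{<t}]. *)
Definition grad_term theta t : 'rV[R]_d :=
  vmean (joint theta) (fun y => cond_cov theta (take t.-1 y)).

Definition expected_harm theta : R := mean (joint theta) Harm.

End Autoregressive.

Definition prefix_tuple (V : Type) (T k : nat) (hk : (k <= T)%N)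
    (y : T.-tuple V) : k.-tuple V :=
  [tuple tnth y (widen_ord hk i) | i < k].

(* Main.v *)
(* The functions h satisfy h_{t-1}(s) = sum_v P(v | s) h_t(s v) identically in
   theta, with h_T = Harm constant and h_0 = E[Harm]. Differentiating this
   recursion by the product rule gives grad h_{t-1} = (covariance term) +
   E[grad h_t | s], because the log-derivative trick turns the covariance with
   the score into sum_v h_t(s v) grad P(v | s); taking expectations, the
   recursion telescopes to the gradient identity.
   Since every sequence has positive probability, I_t = 0 forces
   h_t(s v) = h_{t-1}(s) for all s and v; the t-th term is then
   h_{t-1}(s) * grad (sum_v P(v | s)) = 0. If this holds for all t > k, then
   Harm = h_T = h_k depends on the first k tokens only, and conversely. *)

Require Import Defs.
From HB Require Import structures.
From mathcomp Require Import all_boot all_order all_algebra.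
From mathcomp Require Import all_classical all_reals all_analysis.

Set Implicit Arguments.
Unset Strict Implicit.
Unset Printing Implicit Defensive.

Import Order.TTheory GRing.Theory Num.Theory.
Import numFieldNormedType.Exports.

Local Open Scope ring_scope.

(** * Gradient calculus *)

Lemma grad_cst (R : realType) (d : nat) (c : R) (theta : 'rV[R]_d) :
  grad (fun=> c) theta = 0.
Proof. by apply/rowP => i; rewrite !mxE derive_cst. Qed.

(** Both conclusions are carried through one induction, since additivity of the gradient needs the
    partial sums to be differentiable. *)
Lemma grad_sum (R : realType) (d : nat) (I : finType)
    (f : I -> 'rV[R]_d -> R) (theta : 'rV[R]_d) :
  (forall i, differentiable (f i) theta) ->
  differentiable (fun theta' => \sum_i f i theta') theta /\
  grad (fun theta' => \sum_i f i theta') theta = \sum_i grad (f i) theta.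
Proof.
move=> df; have -> : (fun theta' => \sum_i f i theta') = \sum_i f i.
  by apply/funext => x; rewrite fct_sumE.
apply: (big_ind2 (fun F G => differentiable F theta /\ grad F theta = G)) => //.
- by split; [exact: differentiable_cst | exact: grad_cst].
- move=> F _ G _ [dF <-] [dG <-]; split; first exact: differentiableD.
  by apply/rowP => i; rewrite !mxE deriveD//; exact: diff_derivable.
Qed.

Lemma gradM (R : realType) (d : nat) (f g : 'rV[R]_d -> R) (theta : 'rV[R]_d) :
  differentiable f theta -> differentiable g theta ->
  grad (fun theta' => f theta' * g theta') theta =
    g theta *: grad f theta + f theta *: grad g theta.
Proof.
move=> df dg; apply/rowP => i; rewrite !mxE addrC.
by rewrite -[LHS]/('D_ _ (f * g) theta) deriveM//; exact: diff_derivable.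
Qed.

Lemma grad_ln (R : realType) (d : nat) (f : 'rV[R]_d -> R) (theta : 'rV[R]_d) :
  differentiable f theta -> 0 < f theta ->
  grad (fun theta' => ln (f theta')) theta = (f theta)^-1 *: grad f theta.
Proof.
move=> df f0; have [dl lnE] := is_derive1_ln f0.
move/derivable1_diffP : dl => dl.
apply/rowP => i; rewrite !mxE -[LHS]/('D_ _ (@ln R \o f) theta).
rewrite deriveE; last exact: differentiable_comp.
by rewrite diff_comp//= diff1E// derive1E lnE deriveE// mulrC.
Qed.

(** * Joint law and prefix probabilities *)

Section AutoregressiveTheory.
Context {R : realType} {d : nat} {V : finType} {T : nat}.
Variable M : ar_model R d V T.
Implicit Types (theta : 'rV[R]_d) (y : T.-tuple V) (s : seq V) (v : V).

Lemma joint_gt0 theta y : 0 < joint M theta y.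
Proof.
apply: prodr_gt0 => t _; apply: cond_gt0.
by rewrite size_take size_tuple ltn_ord.
Qed.

(** The sequences extending [s] split according to the token that follows [s]. *)
Lemma sum_has_prefix_rcons (U : nmodType) (F : T.-tuple V -> U) s :
  (size s < T)%N ->
  \sum_(y | has_prefix s y) F y =
  \sum_v \sum_(y | has_prefix (rcons s v) y) F y.
Proof.
move=> sT.
rewrite (partition_big (fun y => tnth y (Ordinal sT)) xpredT)//=.
apply: eq_bigr => v _; apply: eq_bigl => y.
rewrite /has_prefix size_rcons (take_nth v) ?size_tuple// eqseq_rcons.
by rewrite (tnth_nth v).
Qed.

Lemma sum_has_prefix_tuple (U : nmodType) (F : T.-tuple V -> U) y :
  \sum_(y' | has_prefix y y') F y' = F y.
Proof.
rewrite (big_pred1 y)// => y'.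
by rewrite /has_prefix /= size_tuple take_oversize ?size_tuple.
Qed.

Lemma prod_cond_rcons v0 theta s v :
  \prod_(i < (size s).+1)
    cond M theta (take i (rcons s v)) (nth v0 (rcons s v) i) =
  (\prod_(i < size s) cond M theta (take i s) (nth v0 s i)) * cond M theta s v.
Proof.
rewrite big_ord_recr/= nth_rcons ltnn eqxx -cats1 take_size_cat//.
congr (_ * _); apply: eq_bigr => i _; rewrite nth_cat ltn_ord take_cat.
by rewrite ltn_ord.
Qed.

(* The default [v0] is never read: [i] ranges below [size s]. *)
Lemma Pr_has_prefix v0 theta s : (size s <= T)%N ->
  Pr M theta (has_prefix s) =
    \prod_(i < size s) cond M theta (take i s) (nth v0 s i).
Proof.
(* Induction on the number of missing tokens: a full sequence has its joint probability, and a
   shorter prefix sums over its next token, whose conditional probabilities add up to 1. *)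
have [n] := ubnP (T - size s); elim: n s => // n IHn s.
rewrite ltnS => sn; rewrite leq_eqVlt => /orP[/eqP sT|sT].
  have [y ->] : exists y : T.-tuple V, s = y.
    by exists (Tuple (introT eqP sT)).
  rewrite /Pr sum_has_prefix_tuple.
  by rewrite /joint size_tuple; apply: eq_bigr => i _; rewrite (tnth_nth v0).
rewrite /Pr sum_has_prefix_rcons//.
rewrite [LHS](_ : _ = \sum_v (\prod_(i < size s)
    cond M theta (take i s) (nth v0 s i)) * cond M theta s v).
  by rewrite -mulr_sumr cond_sum1// mulr1.
apply: eq_bigr => v _; rewrite -[LHS]/(Pr M theta (has_prefix _)).
rewrite IHn ?size_rcons//; last first.
  by rewrite subnS -ltnS prednK ?subn_gt0//.
exact: prod_cond_rcons.
Qed.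

Section Nonempty.
Variable v0 : V.

Lemma Pr_has_prefix_gt0 theta s : (size s <= T)%N ->
  0 < Pr M theta (has_prefix s).
Proof.
move=> sT; rewrite (Pr_has_prefix v0)//; apply: prodr_gt0 => i _.
apply: cond_gt0; rewrite size_take ltn_ord.
exact: leq_trans (ltn_ord i) sT.
Qed.

Lemma Pr_has_prefix_rcons theta s v : (size s < T)%N ->
  Pr M theta (has_prefix (rcons s v)) =
    Pr M theta (has_prefix s) * cond M theta s v.
Proof.
move=> sT; rewrite !(Pr_has_prefix v0) ?size_rcons//; last exact: ltnW.
exact: prod_cond_rcons.
Qed.

Lemma sum_joint theta : \sum_y joint M theta y = 1.
Proof.
have := Pr_has_prefix v0 theta (s := [::]) (leq0n T).
rewrite big_ord0 => <-; apply: eq_bigl => y.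
by rewrite /has_prefix take0.
Qed.

(** Tower property: after grouping sequences by their first [n] tokens, the chain rule
    [Pr_has_prefix_rcons] matches the two sides block by block. *)
Lemma vmean_prefix_step theta n (F : seq V -> 'rV[R]_d) : (n < T)%N ->
  vmean (joint M theta)
    (fun y => \sum_v cond M theta (take n y) v *: F (rcons (take n y) v)) =
  vmean (joint M theta) (fun y => F (take n.+1 y)).
Proof.
move=> nT.
(* Prefixes are packed as [n]-tuples because the partition needs a [finType] of indices, which
   [seq V] is not. *)
have tT y : size (take n y) == n by rewrite size_takel// size_tuple ltnW.
rewrite /vmean.
rewrite (partition_big (fun y => Tuple (tT y)) xpredT)//=.
rewrite [RHS](partition_big (fun y => Tuple (tT y)) xpredT)//=.
apply: eq_bigr => s _.
have sT : (size s < T)%N by rewrite size_tuple.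
have pE y : (Tuple (tT y) == s) = has_prefix s y.
  by rewrite -val_eqE /has_prefix /= size_tuple.
have takeE y : has_prefix s y -> take n y = s.
  by move=> /eqP yE; rewrite -[RHS]yE size_tuple.
rewrite !(eq_bigl _ _ pE) [RHS](sum_has_prefix_rcons _ sT).
under eq_bigr => y /takeE -> do [].
rewrite -scaler_suml -/(Pr M theta _) scaler_sumr; apply: eq_bigr => v _.
rewrite scalerA -Pr_has_prefix_rcons// /Pr scaler_suml.
apply: eq_bigr => y /eqP yE; congr (_ *: F _).
by rewrite -[LHS]yE size_rcons size_tuple.
Qed.

(** * Conditional expected harm along prefixes *)

Section Harm.
Variable Harm : T.-tuple V -> R.

Lemma h_tuple theta y : h M Harm theta y = Harm y.
Proof.
by rewrite /h /Pr !sum_has_prefix_tuple mulrAC divff ?mul1r// gt_eqF ?joint_gt0.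
Qed.

(** Law of total expectation: the extra factor [cond M theta s v] in the normaliser of the longer
    prefix cancels. *)
Lemma h_rcons theta s : (size s < T)%N ->
  h M Harm theta s = \sum_v cond M theta s v * h M Harm theta (rcons s v).
Proof.
move=> sT; rewrite {1}/h sum_has_prefix_rcons// mulr_suml.
apply: eq_bigr => v _; rewrite /h Pr_has_prefix_rcons//.
rewrite invfM [RHS]mulrCA; congr (_ * _).
by rewrite mulrCA divff ?mulr1// gt_eqF// cond_gt0.
Qed.

Lemma h_nil theta : h M Harm theta [::] = expected_harm M Harm theta.
Proof.
rewrite /h (Pr_has_prefix v0)// big_ord0 divr1.
by apply: eq_bigl => y; rewrite /has_prefix take0.
Qed.

Lemma h_itv theta s : (forall y, 0 <= Harm y <= 1) -> (size s <= T)%N ->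
  0 <= h M Harm theta s <= 1.
Proof.
move=> Harm01 sT; have P0 := Pr_has_prefix_gt0 theta sT.
rewrite /h ler_pdivlMr// ler_pdivrMr// mul0r mul1r; apply/andP; split.
  apply: sumr_ge0 => y _; rewrite mulr_ge0 ?(ltW (joint_gt0 _ _))//.
  by case/andP: (Harm01 y).
apply: ler_sum => y _; rewrite ler_piMr ?(ltW (joint_gt0 _ _))//.
by case/andP: (Harm01 y).
Qed.

Lemma h_const theta s c : (size s <= T)%N ->
  (forall y, has_prefix s y -> Harm y = c) -> h M Harm theta s = c.
Proof.
move=> sT Hc; rewrite /h (eq_bigr (fun y => joint M theta y * c)); last first.
  by move=> y /Hc ->.
by rewrite -mulr_suml mulrAC divff ?mul1r// gt_eqF// Pr_has_prefix_gt0.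
Qed.

(** * Covariance with the score and the gradient identity *)

Lemma sum_grad_cond theta s : (size s < T)%N ->
  \sum_v grad (fun theta' => cond M theta' s v) theta = 0.
Proof.
move=> sT.
have [_ <-] := grad_sum (fun v => cond_diff M theta v sT).
rewrite -[RHS](grad_cst (1 : R) theta); congr grad.
by apply/funext => x; rewrite cond_sum1.
Qed.

(* The score has mean zero and both centring terms of the covariance vanish,
   because the conditional probabilities sum to 1. *)
Lemma cond_covE theta s : (size s < T)%N ->
  cond_cov M Harm theta s =
  \sum_v h M Harm theta (rcons s v) *:
    grad (fun theta' => cond M theta' s v) theta.
Proof.
move=> sT; have scoreE v : cond M theta s v *: score M theta s v =
    grad (fun theta' => cond M theta' s v) theta.
  rewrite /score grad_ln ?cond_gt0//; last exact: cond_diff.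
  by rewrite scalerA divff ?scale1r// gt_eqF// cond_gt0.
have score0 : vmean (cond M theta s) (score M theta s) = 0.
  by rewrite /vmean (eq_bigr _ (fun v _ => scoreE v)) sum_grad_cond.
rewrite /cond_cov /vcov score0 /vmean.
transitivity (\sum_v (h M Harm theta (rcons s v) - mean (cond M theta s)
    (fun v => h M Harm theta (rcons s v))) *:
    grad (fun theta' => cond M theta' s v) theta).
  by apply: eq_bigr => v _; rewrite subr0 -scoreE !scalerA mulrC.
under eq_bigr do rewrite scalerBl.
by rewrite sumrB -scaler_sumr sum_grad_cond// scaler0 subr0.
Qed.

(** Backward induction from full sequences, where [h] is the constant [Harm y]. Differentiability is
    proved alongside because the product rule at [s] requires it at every [rcons s v]. *)
Lemma grad_h theta s : (size s <= T)%N ->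
  differentiable (fun theta' => h M Harm theta' s) theta /\
  ((size s < T)%N -> grad (fun theta' => h M Harm theta' s) theta =
    cond_cov M Harm theta s + \sum_v cond M theta s v *:
      grad (fun theta' => h M Harm theta' (rcons s v)) theta).
Proof.
have [n] := ubnP (T - size s); elim: n s => // n IHn s.
rewrite ltnS => sn; rewrite leq_eqVlt => /orP[/eqP sT|sT].
  split; last by rewrite sT ltnn.
  have [y ->] : exists y : T.-tuple V, s = y.
    by exists (Tuple (introT eqP sT)).
  rewrite (_ : (fun _ => _) = cst (Harm y)); first exact: differentiable_cst.
  by apply/funext => x; rewrite h_tuple.
have dh v : differentiable (fun theta' => h M Harm theta' (rcons s v)) theta.
  have [||//] := IHn (rcons s v); rewrite size_rcons//.
  by rewrite subnS -ltnS prednK ?subn_gt0.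
have dc v := cond_diff M theta v sT.
have -> : (fun theta' => h M Harm theta' s) = (fun theta' =>
    \sum_v cond M theta' s v * h M Harm theta' (rcons s v)).
  by apply/funext => x; rewrite h_rcons.
have [dS ->] := grad_sum (fun v => differentiableM (dc v) (dh v)).
split=> // _; rewrite cond_covE// -big_split/=; apply: eq_bigr => v _.
exact: gradM.
Qed.

Lemma grad_expected_harm theta :
  differentiable (expected_harm M Harm) theta /\
  grad (expected_harm M Harm) theta =
    \sum_(1 <= t < T.+1) grad_term M Harm theta t.
Proof.
have -> : expected_harm M Harm = fun theta' => h M Harm theta' [::].
  by apply/funext => x; rewrite h_nil.
have [dh _] := grad_h theta (leq0n T : (size [::] <= T)%N).
split=> //.
(* [G n] is the mean gradient of [h] at the prefix of length [n]: it starts at the gradient of the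
   expected harm, ends at 0, and drops by one gradient term per step. *)
pose G n := vmean (joint M theta)
  (fun y => grad (fun theta' => h M Harm theta' (take n y)) theta).
have G0 : G 0 = grad (fun theta' => h M Harm theta' [::]) theta.
  rewrite /G /vmean; under eq_bigr do rewrite take0.
  by rewrite -scaler_suml sum_joint scale1r.
have GT : G T = 0.
  rewrite /G /vmean big1// => y _.
  rewrite (_ : (fun _ => _) = fun=> Harm y) ?grad_cst ?scaler0//.
  by apply/funext => x; rewrite take_oversize ?size_tuple// h_tuple.
have GS n : (n < T)%N -> G n = grad_term M Harm theta n.+1 + G n.+1.
  move=> nT; rewrite /G -(vmean_prefix_step _ (fun s =>
    grad (fun theta' => h M Harm theta' s) theta) nT).
  rewrite /grad_term /vmean -big_split/=; apply: eq_bigr => y _.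
  have tT : (size (take n y) < T)%N by rewrite size_takel ?size_tuple// ltnW.
  by rewrite -scalerDr; have [_ ->] := grad_h theta (ltnW tT).
(* [big_add1] turns 1-based positions into 0-based lengths; the sign in [- G n] makes each summand
   an upward difference. *)
rewrite -G0 big_add1/=.
rewrite (telescope_sumr_eq (fun n => - G n)) ?GT ?oppr0 ?sub0r ?opprK//.
by move=> n /andP[_ nT]; rewrite (GS n nT) opprK addrC addrK.
Qed.

(** * Vanishing harm information *)

Lemma harm_info_eq0 theta t :
  harm_info M Harm theta t = 0 <->
  forall y, innovation M Harm theta t y = 0.
Proof.
rewrite /harm_info /mean; split=> [I0 y|I0]; last first.
  by rewrite big1// => y _; rewrite I0 expr0n mulr0.
have ge0 y' : true -> 0 <= joint M theta y' * innovation M Harm theta t y' ^+ 2.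
  by rewrite mulr_ge0 ?sqr_ge0 ?(ltW (joint_gt0 _ _)).
(* A zero sum of nonnegative terms has zero terms, and the weight [joint] is positive. *)
have /eqP := psumr_eq0P ge0 I0 (i := y) isT.
by rewrite mulf_eq0 gt_eqF ?joint_gt0//= expf_eq0/= => /eqP.
Qed.

Lemma innovation_eq0_rcons theta t y v : (0 < t <= T)%N ->
  (forall y, innovation M Harm theta t y = 0) ->
  h M Harm theta (rcons (take t.-1 y) v) = h M Harm theta (take t.-1 y).
Proof.
case: t => // t /= tT I0.
(* A full sequence in which [v] follows the prefix, so that the hypothesis at [x] speaks about [v];
   the padding with [v0] is arbitrary. *)
pose x := rcons (take t y) v ++ nseq (T - t.+1) v0.
have st : size (take t y) = t by rewrite size_takel// size_tuple ltnW.
have xT : size x == T by rewrite size_cat size_rcons st size_nseq subnKC.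
have /eqP := I0 (Tuple xT); rewrite /innovation subr_eq0 /= => /eqP.
rewrite take_size_cat ?size_rcons ?st// => ->; congr h.
by rewrite /x -cats1 -catA take_size_cat.
Qed.

Lemma grad_term_eq0 theta t : (0 < t <= T)%N ->
  harm_info M Harm theta t = 0 -> grad_term M Harm theta t = 0.
Proof.
move=> tT /harm_info_eq0 I0; rewrite /grad_term /vmean big1// => y _.
have sT : (size (take t.-1 y) < T)%N.
  by case: t tT {I0} => // t /= tT; rewrite size_takel ?size_tuple// ltnW.
rewrite cond_covE//; under eq_bigr do rewrite innovation_eq0_rcons//.
by rewrite -scaler_sumr sum_grad_cond// !scaler0.
Qed.

Lemma tval_prefix_tuple k (hk : (k <= T)%N) y :
  prefix_tuple hk y = take k y :> seq V.
Proof.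
apply: (@eq_from_nth _ v0) => [|i]; rewrite size_tuple.
  by rewrite size_takel// size_tuple.
move=> ik; rewrite nth_take// -[i]/(nat_of_ord (Ordinal ik)) -tnth_nth.
by rewrite tnth_mktuple (tnth_nth v0).
Qed.

Lemma harm_info_eq0_prefix theta k (hk : (k <= T)%N) :
  (forall y, 0 <= Harm y <= 1) ->
  (forall t, (k < t <= T)%N -> harm_info M Harm theta t = 0) <->
  exists g : k.-tuple V -> R, (forall z, 0 <= g z <= 1) /\
    Pr M theta (fun y => Harm y == g (prefix_tuple hk y)) = 1.
Proof.
move=> Harm01; split=> [I0|[g [_ g1]] t /andP[kt tT]].
  (* The witness is [h] itself at length [k], which [h_itv] keeps in the unit interval. *)
  exists (fun z : k.-tuple V => h M Harm theta z); split=> [s|].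
    by apply: h_itv; rewrite ?size_tuple.
  rewrite -[RHS](sum_joint theta); apply: eq_bigl => y.
  rewrite tval_prefix_tuple -(h_tuple theta).
  (* [Harm y] is read as [h] at length [T], so that zero innovations carry it down to length [k]. *)
  rewrite -[in X in X == _](@take_oversize _ T y) ?size_tuple//.
  have hE n : (k + n <= T)%N ->
      h M Harm theta (take (k + n) y) = h M Harm theta (take k y).
    elim: n => [|n IHn]; first by rewrite addn0.
    rewrite addnS => kn; rewrite -IHn; last exact: ltnW.
    have /harm_info_eq0/(_ y)/eqP : harm_info M Harm theta (k + n).+1 = 0.
      by apply: I0; rewrite ltnS leq_addr.
    by rewrite /innovation subr_eq0 => /eqP.
  by have := hE (T - k)%N; rewrite subnKC// => ->; rewrite ?eqxx.
(* Equality with probability 1 is equality everywhere: the complement has mass 0, but every sequence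
   has positive mass. *)
have gE y : Harm y = g (prefix_tuple hk y).
  have := sum_joint theta.
  rewrite (bigID (fun y => Harm y == g (prefix_tuple hk y)))/=.
  rewrite -/(Pr M theta _) g1 => /(canRL (addKr _)); rewrite addNr.
  move=> /psumr_eq0P P0; apply/eqP/negPn/negP => /P0.
  move=> /(_ (fun y _ => ltW (joint_gt0 theta y)))/eqP.
  by rewrite gt_eqF ?joint_gt0.
apply/harm_info_eq0 => y.
(* Once the first [k] tokens are fixed, [Harm] is constant; as [k < t], this covers both lengths [t]
   and [t.-1] in the innovation. *)
have hg n : (k <= n <= T)%N ->
    h M Harm theta (take n y) = g (prefix_tuple hk y).
  move=> /andP[kn nT]; apply: h_const => [|y'].
    by rewrite size_takel ?size_tuple.
  rewrite /has_prefix size_takel ?size_tuple// => /eqP yE.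
  rewrite gE; congr g; apply: val_inj.
  rewrite [LHS](tval_prefix_tuple hk y') [RHS](tval_prefix_tuple hk y).
  by rewrite -(take_takel y' kn) yE take_takel.
rewrite /innovation !hg ?subrr ?tT ?(ltnW kt)//.
by case: t kt tT => // t kt /ltnW ->; rewrite -ltnS kt.
Qed.

End Harm.
End Nonempty.
End AutoregressiveTheory.

Theorem theorem10 (R : realType) (d : nat) (V : finType) (T : nat)
    (hT : (1 <= T)%N) (M : ar_model R d V T) (Harm : T.-tuple V -> R)
    (hHarm : forall y, 0 <= Harm y <= 1) (theta : 'rV[R]_d)
    (k : nat) (hk : (k <= T)%N) :
  ((forall t : nat, (k < t <= T)%N -> harm_info M Harm theta t = 0) <->
   (exists g : k.-tuple V -> R, (forall s, 0 <= g s <= 1) /\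
      Pr M theta (fun y => Harm y == g (prefix_tuple hk y)) = 1))
  /\
  ((forall t : nat, (k < t <= T)%N -> harm_info M Harm theta t = 0) ->
   forall t : nat, (k < t <= T)%N -> grad_term M Harm theta t = 0)
  /\
  (differentiable (expected_harm M Harm) theta /\
   grad (expected_harm M Harm) theta =
     \sum_(1 <= s < T.+1) grad_term M Harm theta s).
Proof.
(* The vocabulary is nonempty: otherwise the conditional probabilities at the empty prefix,
   constrained since [1 <= T], would sum to 0. *)
have [v0 _|V0] := pickP (@predT V); last first.
  have /eqP := cond_sum1 M theta (s := [::]) hT.
  by rewrite big_pred0// eq_sym oner_eq0.
split; first exact: harm_info_eq0_prefix.
split; last exact: grad_expected_harm.
move=> I0 t kt; apply: grad_term_eq0 => //; last exact: I0.
by case/andP: kt => kt ->; rewrite (leq_ltn_trans _ kt).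
Qed.
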